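(* Let $\mu=(\mu_1\ge\mu_2\ge\cdots)$ be a partition of $n$. Then $$\mathbf{H}_\mu(A;q,t)=\frac{q^{-n(\mu')+\binom{\mu_1}{2}}}{(q-1)^{n-\mu_1}}\sum_{G_\mu\subseteq H\subseteq G_\mu^+}\ \prod_{u\in H\backslash G_\mu}\big(1-t^{1+\mathrm{leg}(u)}q^{\mathrm{arm}(u)}\big)\prod_{u\in G_\mu^+\backslash H}\big(t^{1+\mathrm{leg}(u)}q^{\mathrm{arm}(u)+1}-1\big)\ \omega\widetilde{\mathbf{LLT}}_H(A;q),$$ where $\widetilde{\mathbf{LLT}}_H(A;q)=q^{e(H)}\mathbf{LLT}_H(A;q^{-1})$, $e(H)$ being the number of edges of $H$.
   Context: Packed words and $\mathbf{WQSym}$. A word $u$ over the positive integers is packed if the set of its letters is $\{1,\dots,r\}$, $r=\max(u)$; it encodes the set composition $(u^{-1}(1),\dots,u^{-1}(r))$ of the set of positions. For packed words of the same length, $v\le u$ (''$u$ is finer than $v$'') means that the set composition of $v$ is obtained from that of $u$ by merging adjacent blocks. $\mathbf{WQSym}$ is the algebra of quasi-symmetric functions in noncommuting variables, with basis $\mathbf{M}_u=\sum_{\mathrm{pack}(w)=u}w$ ($u$ packed; $\mathrm{pack}(w)$ replaces the letters of $w$ by $1,2,\dots$ in an order-preserving way). The $\omega$-involution is the linear map $\omega\mathbf{M}_u=(-1)^{n-r}\sum_{v\le u}\mathbf{M}_v$, $n=|u|$, $r=\max(u)$. The standardization $\mathrm{std}(u)$ of a word of length $n$ is the permutation $\sigma\in\mathfrak{S}_n$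 such that, for $i<j$, $\sigma_i<\sigma_j$ iff $u_i\le u_j$. For $\sigma\in\mathfrak{S}_n$, $\min(\sigma)$ is the coarsest packed word with standardization $\sigma$, and $\Phi_{\min(\sigma)}=\sum_{\mathrm{std}(v)=\sigma}\mathbf{M}_v$ (sum over packed words $v$). LLT. For a simple graph $H$ on $\{1,\dots,n\}$, $\mathbf{LLT}_H(A;t)=\sum_w t^{\mathrm{asc}_H(w)}\mathbf{M}_w$, sum over all packed words $w$ of length $n$, where $\mathrm{asc}_H(w)$ is the number of edges $\{i,j\}$ with $i<j$ and $w_i<w_j$. Diagrams. The diagram of $\mu$ is drawn in French notation (rows of lengths $\mu_1,\mu_2,\dots$ from bottom to top, left-justified); $R_1$ is the bottom row. $\mathrm{arm}(u)$ is the number of cells strictly to the right of $u$ in its row, $\mathrm{leg}(u)$ the number of cells strictly above $u$ in its column; $\mathrm{South}(u)$ is the cell just below $u\notin R_1$. $n(\mu)=\sum_i(i-1)\mu_i$, and $\mu'$ is the conjugate partition, so $n(\mu')=\sum_i\binom{\mu_i}{2}$. Cells are numbered $1,\dots,n$ in reading order: rows from top to bottom, each row from left to right; a permutation $\sigma\in\mathfrak{S}_n$ is the filling of $\mu$ with $\sigma_i$ in the $i$-th cell. Two cells attack each other if they are in the same row, or in consecutive rows with the cell of the upper row strictly to the right of the cell of the lower row. $\mathrm{Inv}(\sigma,\mu)$ (as an exponent: its cardinality) is the set of attacking pairs of cells such that the one that comes first in reading order has the larger entry. $\mathrm{Des}(\sigma,\mu)$ is the set of cells $u\notin R_1$ whose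 entry is greater than that of $\mathrm{South}(u)$. (These are the Haglund–Haiman–Loehr statistics: $\mathrm{inv}(\sigma,\mu)=|\mathrm{Inv}(\sigma,\mu)|-\sum_{u\in\mathrm{Des}(\sigma,\mu)}\mathrm{arm}(u)$, $\mathrm{maj}(\sigma,\mu)=\sum_{u\in\mathrm{Des}(\sigma,\mu)}(1+\mathrm{leg}(u))$.) The noncommutative Macdonald polynomial is $$\mathbf{H}_\mu(A;q,t)=\sum_{\sigma\in\mathfrak{S}_n}t^{\,n(\mu)-\mathrm{maj}(\sigma,\mu)}q^{\,\mathrm{inv}(\sigma,\mu)}\,\Phi_{\min(\sigma)}.$$ Haglund–Wilson graphs. $G_\mu$ is the graph on $\{1,\dots,n\}$ (the cells numbered in reading order) whose edges are the attacking pairs; $G_\mu^+$ has in addition all edges $\{u,\mathrm{South}(u)\}$ for $u\notin R_1$. The sum is over all graphs $H$ on $\{1,\dots,n\}$ with edge set between those of $G_\mu$ and $G_\mu^+$. In the products, $u\in H\backslash G_\mu$ (resp. $u\in G_\mu^+\backslash H$) means that $u$ runs over the cells $u\notin R_1$ such that the edge $\{u,\mathrm{South}(u)\}$ belongs (resp. does not belong) to $H$. *)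

(* Defs.v *)
From HB Require Import structures.
From mathcomp Require Import all_boot all_order all_fingroup all_algebra.
From mathcomp Require Import functions.
Set Implicit Arguments.
Unset Strict Implicit.
Unset Printing Implicit Defensive.

Import Order.TTheory GRing.Theory Num.Theory.

(** * Words *)

Definition word (n : nat) := {ffun 'I_n -> nat}.

(** A packed word of length [n] has its letters in [{1, ..., n}], so packed
    words are taken in the finite type [fword n]. *)
Definition fword (n : nat) := {ffun 'I_n -> 'I_n.+1}.

Section Words.
Variable n : nat.

Definition word_of (u : fword n) : word n := [ffun i => u i : nat].

Definition wmax (u : fword n) : nat := \max_(i < n) u i.

Definition packed (u : fword n) : bool :=
  [set u i | i : 'I_n] == [set k : 'I_n.+1 | 0 < k <= wmax u].

(** The rank of a letter is the number of distinct letters at most equal to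
    it. *)
Definition pack (w : word n) : word n :=
  [ffun i => size (undup [seq w j | j <- enum 'I_n & w j <= w i])].

(** [block u k] is the [k]-th block of the set composition encoded by [u]
    (empty unless [1 <= k <= wmax u] when [u] is packed). *)
Definition block (u : fword n) (k : 'I_n.+1) : {set 'I_n} :=
  [set i | u i == k].

(** [v <= u]: the [k]-th block of [v] is the union of the blocks of [u] with
    index [j] such that [f j = k]; as [f] is nondecreasing, these are
    consecutive blocks. *)
Definition merges (v u : fword n) : bool :=
  [exists f : {ffun 'I_n.+1 -> 'I_n.+1},
    [forall j : 'I_n.+1, forall k : 'I_n.+1, (j <= k) ==> (f j <= f k)] &&
    [forall k, block v k == \bigcup_(j | f j == k) block u j]].

(** [std u = s]. The entries of a permutation are [0, ..., n-1] instead of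
    [1, ..., n]; only their comparison matters. *)
Definition is_std (u : fword n) (s : 'S_n) : bool :=
  [forall i : 'I_n, forall j : 'I_n,
    (i < j) ==> ((s i < s j) == (u i <= u j))].

End Words.

(** * Graphs on [n] vertices, given by their sets of edges [[set i; j]] *)

Definition graph (n : nat) := {set {set 'I_n}}.

Definition asc (n : nat) (H : graph n) (w : fword n) : nat :=
  #|[set p : 'I_n * 'I_n |
      [&& p.1 < p.2, [set p.1; p.2] \in H & w p.1 < w p.2]]|.

(** * Diagrams *)

Definition is_partition_of (n : nat) (mu : seq nat) : bool :=
  [&& sorted geq mu, 0 \notin mu & sumn mu == n].

Definition npart (mu : seq nat) : nat := \sum_(i < size mu) i * nth 0 mu i.

Definition conj_part (mu : seq nat) : seq nat :=
  [seq count (fun m => j < m) mu | j <- iota 0 (head 0 mu)].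

(** Cells [(r, c)] in reading order, where [r] is the row index counted from
    the bottom and [c] the column index counted from the left, both from 0. *)
Definition cells (mu : seq nat) : seq (nat * nat) :=
  [seq (r, c) | r <- rev (iota 0 (size mu)), c <- iota 0 (nth 0 mu r)].

Section Diagram.
Variables (n : nat) (mu : seq nat).

(** For a partition [mu] of [n], cells are identified with their position
    [u : 'I_n] in reading order. *)
Definition cell (u : 'I_n) : nat * nat := nth (0, 0) (cells mu) u.
Definition crow (u : 'I_n) : nat := (cell u).1.
Definition ccol (u : 'I_n) : nat := (cell u).2.

Definition in_bottom (u : 'I_n) : bool := crow u == 0.

Definition arm (u : 'I_n) : nat :=
  #|[set v : 'I_n | (crow v == crow u) && (ccol u < ccol v)]|.

Definition leg (u : 'I_n) : nat :=
  #|[set v : 'I_n | (ccol v == ccol u) && (crow u < crow v)]|.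

(** Only used for [u] not in the bottom row, where the cell exists. *)
Definition South (u : 'I_n) : 'I_n :=
  odflt u [pick v : 'I_n | cell v == ((crow u).-1, ccol u)].

Definition attack (u v : 'I_n) : bool :=
  [|| (u != v) && (crow u == crow v),
      (crow u == (crow v).+1) && (ccol v < ccol u)
    | (crow v == (crow u).+1) && (ccol u < ccol v)].

Definition Inv (s : 'S_n) : {set 'I_n * 'I_n} :=
  [set p | [&& attack p.1 p.2, p.1 < p.2 & s p.2 < s p.1]].

Definition Des (s : 'S_n) : {set 'I_n} :=
  [set u | ~~ in_bottom u && (s (South u) < s u)].

Definition inv (s : 'S_n) : int :=
  (#|Inv s|%:Z - (\sum_(u in Des s) arm u)%N%:Z)%R.

Definition maj (s : 'S_n) : nat := \sum_(u in Des s) (1 + leg u).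

Definition Gmu : graph n := [set [set p.1; p.2] | p : 'I_n * 'I_n & attack p.1 p.2].

Definition Gmu_plus : graph n :=
  Gmu :|: [set [set u; South u] | u : 'I_n & ~~ in_bottom u].

End Diagram.

(** * Elements of WQSym, homogeneous of degree [n] *)

(** The alphabet is [nat] with its usual order. A noncommutative series,
    homogeneous of degree [n], is the function mapping a word to its
    coefficient. *)
Notation ncseries K n := (word n -> GRing.regular K).

Section WQSym.
Local Open Scope ring_scope.
Variables (K : fieldType) (n : nat).

Definition M (u : fword n) : ncseries K n :=
  fun w => (pack w == word_of u)%:R.

(** An element [F] of WQSym is the sum over packed [u] of [F (word_of u) *: M u],
    see [WQSym_expand]; [omega] is the linear extension of its values on the
    basis, see [omegaM]. *)
Definition omega (F : ncseries K n) : ncseries K n :=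
  \sum_(u : fword n | packed u)
    F (word_of u) *:
      ((-1) ^+ (n - wmax u) *: \sum_(v : fword n | packed v && merges v u) M v).

(** [Phi] indexed by [min s], the coarsest packed word with standardization
    [s]. *)
Definition Phi_min (s : 'S_n) : ncseries K n :=
  \sum_(v : fword n | packed v && is_std v s) M v.

Definition LLT (H : graph n) (x : K) : ncseries K n :=
  \sum_(w : fword n | packed w) x ^+ asc H w *: M w.

Definition LLT_tilde (H : graph n) (q : K) : ncseries K n :=
  q ^+ #|H| *: LLT H q^-1.

Definition Hmac (mu : seq nat) (q t : K) : ncseries K n :=
  \sum_(s : 'S_n)
    (t ^ ((npart mu)%:Z - (maj mu s)%:Z) * q ^ inv mu s) *: Phi_min s.

Lemma pack_packed (u : fword n) : packed u -> pack (word_of u) = word_of u.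
Proof.
move=> /eqP pu; apply/ffunP => i; rewrite !ffunE.
have mem_u (k : 'I_n.+1) : (0 < k <= wmax u)%N = [exists j, u j == k].
  have /setP/(_ k) := pu; rewrite !inE => <-.
  apply/imsetP/existsP => [[j _ ->]|[j /eqP <-]]; first by exists j.
  by exists j.
rewrite -[RHS](size_iota 1); apply/perm_size/uniq_perm.
- exact: undup_uniq.
- exact: iota_uniq.
move=> k; rewrite mem_undup mem_iota add1n ltnS.
apply/mapP/andP => [[j]|[k0 kle]].
  rewrite mem_filter !ffunE => /andP[uji _] ->; split=> //.
  have : [exists j', u j' == u j] by apply/existsP; exists j.
  by rewrite -mem_u => /andP[].
have kn : (k < n.+1)%N by rewrite ltnS (leq_trans kle)// -ltnS.
have : [exists j, u j == Ordinal kn].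
  rewrite -mem_u /= k0 (leq_trans kle)//.
  exact: (@leq_bigmax _ (fun i => u i : nat) i).
move=> /existsP[j /eqP uj]; exists j; last by rewrite ffunE uj.
by rewrite mem_filter ffunE uj kle mem_enum.
Qed.

Lemma M_word_of (u v : fword n) :
  packed v -> M u (word_of v) = (v == u)%:R.
Proof.
move=> pv; rewrite /M pack_packed//; congr (_%:R); congr nat_of_bool.
apply/eqP/eqP => [/ffunP e|->//]; apply/ffunP => i.
by have := e i; rewrite !ffunE => /val_inj.
Qed.

Lemma WQSym_expand (a : fword n -> K) :
  let F : ncseries K n := \sum_(u : fword n | packed u) a u *: M u in
  F = \sum_(u : fword n | packed u) F (word_of u) *: M u.
Proof.
move=> F; apply: eq_bigr => v pv; congr (_ *: _).
rewrite /F fct_sumE (bigD1 v)//= big1 => [|u /andP[_ /negPf uv]].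
  by rewrite addr0 -[RHS]/(a v * M v (word_of v)) M_word_of// eqxx mulr1.
by rewrite -[LHS]/(a u * M u (word_of v)) M_word_of// eq_sym uv mulr0.
Qed.

Lemma omegaM (u : fword n) : packed u ->
  omega (M u) =
  (-1) ^+ (n - wmax u) *: \sum_(v : fword n | packed v && merges v u) M v.
Proof.
move=> pu; rewrite /omega (bigD1 u)//= M_word_of// eqxx scale1r.
rewrite [X in _ + X]big1 ?addr0// => v /andP[pv /negPf vu].
by rewrite M_word_of// vu scale0r.
Qed.

End WQSym.

Arguments Hmac {K} n mu q t.

(* Main.v *)
(** Both sides are expanded on the basis [M v]. Expanding each factor of
    [q ^ #non-ascents = prod (q + (1 - q) [u_i < u_j])] reduces
    [omega (LLT_tilde H q)] to signed sums, over packed words [u] refining [v],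
    with strict order constraints; such a sum is [1] as soon as the constraints
    are acyclic. Hence the coefficient of [M v] in [omega (LLT_tilde H q)] is
    [q] to the number of strict descents of [v] along the edges of [H]. The sum
    over [H] then factors over the cells [u] outside the bottom row, with factor
    [q - 1] if [u] is a descent of [v], and [t^(1 + leg u) q^(arm u) (q - 1)]
    otherwise. *)

Require Import Defs.
From mathcomp Require Import all_boot all_order all_fingroup all_algebra.
From mathcomp Require Import functions.
From mathcomp Require Import ring zify.
Import GRing.Theory.
Local Open Scope ring_scope.

(** * Expansion of a product of two-term sums over subsets *)

Lemma prod_subset_distr (R : comPzRingType) (I : finType) (N : {set I})
    (F G : I -> R) :
  \prod_(i in N) (F i + G i) =
  \sum_(J : {set I} | J \subset N)
    (\prod_(i in J) F i) * \prod_(i in N :\: J) G i.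
Proof.
(* Outside [N] the factor 1 is written [0 + 1]. Distributivity then applies over all subsets, and
   those not contained in [N] contribute 0. *)
have -> : \prod_(i in N) (F i + G i) =
    \prod_i ((if i \in N then F i else 0) + (if i \in N then G i else 1)).
  by rewrite big_mkcond; apply: eq_bigr => i _; case: ifP; rewrite ?add0r.
rewrite bigA_distr (bigID (fun J : {set I} => J \subset N)) /= addrC big1.
  rewrite add0r; apply: eq_bigr => J /subsetP sJN.
  rewrite (bigID (mem J)) /=; congr (_ * _).
    by apply: eq_bigr => i iJ; rewrite iJ sJN.
  rewrite big_mkcond [RHS]big_mkcond; apply: eq_bigr => i _.
  by rewrite !inE; case: (i \in J).
move=> J /subsetPn [i iJ iN].
by rewrite (bigD1 i) //= iJ (negPf iN) mul0r.
Qed.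

(** * Signed sums over packed words *)

Section PackedOn.
Variable n : nat.
Implicit Types (A L : {set 'I_n}) (u : fword n) (E : rel 'I_n).

(** [u] encodes a set composition of [A]; the letter [0] marks the positions
    outside [A]. *)
Definition packed_on A u : bool :=
  ([set i | (0 < u i)%N] == A) &&
  [forall k : 'I_n.+1, (0 < k <= wmax u)%N ==> [exists i, u i == k]].

Definition increasing_on E A u : bool :=
  [forall i in A, forall j in A, E i j ==> (u i < u j)%N].

Definition top_block A u : {set 'I_n} := [set i in A | u i == wmax u :> nat].

Definition sinks E A : {set 'I_n} := [set i in A | [forall j in A, ~~ E i j]].

Lemma leq_wmax u i : (u i <= wmax u)%N.
Proof. exact: (@leq_bigmax _ (fun i => u i : nat) i). Qed.

Lemma packed_onP A u :
  reflect ((forall i, (0 < u i)%N = (i \in A)) /\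
           (forall k, (0 < k <= wmax u)%N -> exists i, u i = k :> nat))
          (packed_on A u).
Proof.
apply: (iffP andP) => [[/eqP <- /forallP h]|[h1 h2]]; split.
- by move=> i; rewrite inE.
- move=> k kP; have kn : (k < n.+1)%N.
    by case/andP: kP => _ /leq_trans; apply; apply/bigmax_leqP => i _; rewrite -ltnS.
  have /existsP [i /eqP ui] := implyP (h (Ordinal kn)) kP.
  by exists i; rewrite ui.
- by apply/eqP/setP => i; rewrite inE.
- apply/forallP => k; apply/implyP => /h2 [i ui].
  by apply/existsP; exists i; apply/eqP/val_inj.
Qed.

Lemma packed_packed_on u : packed u = packed_on setT u.
Proof.
apply/eqP/packed_onP => [e|[h1 h2]].
  have H k : (k \in [set u i | i : 'I_n]) = (0 < k <= wmax u)%N.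
    by rewrite e inE.
  split=> [i|k kP].
    by rewrite inE; have := H (u i); rewrite imset_f // => /esym /andP [].
  have kn : (k < n.+1)%N.
    by case/andP: kP => _ /leq_trans; apply; apply/bigmax_leqP => i _; rewrite -ltnS.
  have := H (Ordinal kn); rewrite kP => /imsetP [i _ ui].
  by exists i; rewrite -ui.
apply/setP => k; rewrite inE; apply/imsetP/idP => [[i _ ->]|/h2 [i ui]].
  by rewrite h1 inE leq_wmax.
by exists i => //; apply/val_inj.
Qed.

Lemma wmax_card A u : packed_on A u -> (wmax u <= #|A|)%N.
Proof.
move=> /packed_onP [h1 h2].
have h (k : 'I_(wmax u)) : exists i, (u i == k.+1 :> nat).
  by have [|i ui] := h2 k.+1; [rewrite /= ltn_ord | exists i; apply/eqP].
pose f k := xchoose (h k).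
have uf k : u (f k) = k.+1 :> nat by apply/eqP/(xchooseP (h k)).
have fI : injective f.
  by move=> k l e; apply/val_inj/succn_inj; rewrite /= -!uf e.
rewrite -[leqLHS]card_ord -(card_imset _ fI).
by apply/subset_leq_card/subsetP => _ /imsetP [k _ ->]; rewrite -h1 uf.
Qed.

Lemma wmax_attained A u : packed_on A u -> A != set0 ->
  (0 < wmax u)%N /\ exists i, u i = wmax u :> nat.
Proof.
move=> /packed_onP [h1 h2] /set0Pn [i]; rewrite -h1 => ui.
have r0 : (0 < wmax u)%N := leq_trans ui (leq_wmax u i).
by split=> //; apply: h2; rewrite r0 /=.
Qed.

(** A position of [A] where [h] is maximal is a sink. The height [h] is the form in which acyclicity
    of [E] is assumed. *)
Lemma sinks_neq0 E (h : 'I_n -> nat) A :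
  (forall i j, E i j -> (h i < h j)%N) -> A != set0 -> sinks E A != set0.
Proof.
move=> hE /set0Pn [i0 i0A]; case: (arg_maxnP h i0A) => i iA imax.
apply/set0Pn; exists i; rewrite inE [i \in A]iA /=.
apply/forall_inP => j jA; apply/negP => /hE; rewrite ltnNge => /negP; apply.
exact: imax.
Qed.

(** Together with the term 1 of the empty set, the sum is the expansion of the product over [A] of
    [-1 + 1], which vanishes. *)
Lemma sum_sign_subsets (R : comPzRingType) A : A != set0 ->
  \sum_(L : {set 'I_n} | (L \subset A) && (L != set0)) (-1) ^+ #|L| = -1 :> R.
Proof.
move=> /set0Pn [i iA]; apply/eqP; rewrite -addr_eq0 addrC.
have <- : \sum_(L : {set 'I_n} | L \subset A) (-1) ^+ #|L| =
   1 + \sum_(L : {set 'I_n} | (L \subset A) && (L != set0)) (-1) ^+ #|L| :> R.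
  by rewrite (bigD1 set0) ?sub0set //= cards0.
have := @prod_subset_distr R _ A (fun=> -1) (fun=> 1).
rewrite (bigD1 i) //= addNr mul0r => e.
apply/eqP; rewrite [RHS]e; apply: eq_bigr => L _.
by rewrite [X in _ * X]big1 // mulr1 prodr_const.
Qed.

Definition add_top L u : fword n :=
  [ffun i => if i \in L then inord (wmax u).+1 else u i].

Definition drop_top L u : fword n :=
  [ffun i => if i \in L then ord0 else u i].

Lemma wmax_le u k : (forall i, (u i <= k)%N) -> (wmax u <= k)%N.
Proof. by move=> h; apply/bigmax_leqP. Qed.

Lemma wmax_add_top A L u : packed_on (A :\: L) u -> L \subset A -> L != set0 ->
  wmax (add_top L u) = (wmax u).+1 /\
  (forall i, i \in L -> add_top L u i = (wmax u).+1 :> nat).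
Proof.
move=> pu sLA L0.
(* As [L] is nonempty, [wmax u <= #|A :\: L| < #|A| <= n], so the [inord] in [add_top] does not fall
   back to its default. *)
have rn : ((wmax u).+1 < n.+1)%N.
  rewrite ltnS; apply: leq_ltn_trans (wmax_card _ _ pu) _.
  have /subset_leq_card := subsetT A; rewrite cardsT card_ord; apply: leq_trans.
  rewrite -[X in (_ < X)%N](cardsID L) (setIidPr sLA).
  by rewrite -[ltnLHS]add0n ltn_add2r card_gt0.
have topL i : i \in L -> add_top L u i = (wmax u).+1 :> nat.
  by move=> iL; rewrite ffunE iL inordK.
split=> //; apply/eqP; rewrite eqn_leq; apply/andP; split.
  apply: wmax_le => i; have [iL|iL] := boolP (i \in L); first by rewrite topL.
  by rewrite ffunE (negPf iL) leqW ?leq_wmax.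
by have /set0Pn [i iL] := L0; rewrite -(topL i iL) leq_wmax.
Qed.

Lemma drop_topK A u : A != set0 -> packed_on A u ->
  add_top (top_block A u) (drop_top (top_block A u) u) = u /\
  packed_on (A :\: top_block A u) (drop_top (top_block A u) u).
Proof.
move=> A0 pu; have [r0 _] := wmax_attained _ _ pu A0.
have [h1 h2] := packed_onP _ _ pu.
set L := top_block A u; set u' := drop_top L u.
have memL i : (i \in L) = (u i == wmax u :> nat).
  by rewrite inE -h1; case: eqP => [->|//]; rewrite ?r0 ?andbF.
have u'E i : u' i = (if u i == wmax u :> nat then 0 else u i)%N :> nat.
  by rewrite ffunE memL; case: ifP.
(* The letters of [u] on [A] are consecutive, so [(wmax u).-1] is again a letter, or is 0: the
   maximum drops by exactly 1. *)
have ru' : wmax u' = (wmax u).-1.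
  apply/eqP; rewrite eqn_leq; apply/andP; split.
    apply: wmax_le => i; rewrite u'E; case: eqP => // /eqP ne.
    by rewrite -ltnS prednK // ltn_neqAle ne leq_wmax.
  case r1: (wmax u).-1 => [//|k].
  have [|i ui] := h2 (wmax u).-1; first by rewrite {1}r1 /= leq_pred.
  rewrite -r1 -ui; apply: leq_trans (leq_wmax u' i).
  by rewrite u'E ui -[X in _ == X](prednK r0) ltn_eqF.
split.
  apply/ffunP => i; apply/val_inj; rewrite ffunE memL /=.
  case: eqP => [ui|/eqP ui]; last by rewrite u'E (negPf ui).
  rewrite ru' prednK // ui inordK // -ui; exact: ltn_ord.
apply/packed_onP; split=> [i|k].
  by rewrite u'E inE memL -h1; case: eqP.
rewrite ru' => /andP [k0 kr].
have kr' : (k < wmax u)%N by rewrite -(prednK r0) ltnS.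
have [|i ui] := h2 k; first by rewrite k0 ltnW.
by exists i; rewrite u'E ui ltn_eqF.
Qed.

(** The left side is the condition left by reindexing along [add_top L]. Appending [L] as last block
    keeps all constraints: a sink imposes none on the other positions of [A], and those pointing
    into [L] hold because its letter is the largest. *)
Lemma top_blockP E A L u : L \subset sinks E A -> L != set0 ->
  (packed_on A (add_top L u) && increasing_on E A (add_top L u) &&
     (top_block A (add_top L u) == L)) &&
     (drop_top L (add_top L u) == u) =
  packed_on (A :\: L) u && increasing_on E (A :\: L) u.
Proof.
move=> sL L0; have sLA : L \subset A.
  by apply: subset_trans sL _; apply/subsetP => i; rewrite inE => /andP [].
apply/idP/idP.
  case/andP => /andP [/andP [pu iu]] /eqP tL /eqP du.
  have A0 : A != set0 by apply: contraNneq L0 => A0; rewrite -subset0 -A0.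
  have [_] := drop_topK _ _ A0 pu; rewrite tL du => ->; rewrite /=.
  apply/forall_inP => i; rewrite inE => /andP [iL iA].
  apply/forall_inP => j; rewrite inE => /andP [jL jA]; apply/implyP => Eij.
  have /forall_inP/(_ i iA)/forall_inP/(_ j jA) := iu.
  by rewrite Eij !ffunE (negPf iL) (negPf jL).
case/andP => pu iu; have [rE topL] := wmax_add_top _ _ _ pu sLA L0.
have [h1 h2] := packed_onP _ _ pu.
have notL i : i \notin L -> add_top L u i = u i.
  by move=> iL; rewrite ffunE (negPf iL).
have tE i : (add_top L u i == (wmax u).+1 :> nat) = (i \in L).
  case: (boolP (i \in L)) => iL; first by rewrite topL ?eqxx.
  by rewrite notL // ltn_eqF // ltnS leq_wmax.
apply/andP; split; first (apply/andP; split; first (apply/andP; split)).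
- apply/packed_onP; split=> [i|k].
    case: (boolP (i \in L)) => iL; first by rewrite topL // (subsetP sLA).
    by rewrite notL // h1 inE iL.
  rewrite rE => /andP [k0]; rewrite leq_eqVlt => /orP [/eqP ->|].
    by have /set0Pn [i iL] := L0; exists i; apply: topL.
  rewrite ltnS => kr; have [|i ui] := h2 k; first by rewrite k0.
  exists i; rewrite notL //; apply/negP => iL.
  by have := h1 i; rewrite inE iL ui k0.
- apply/forall_inP => i iA; apply/forall_inP => j jA; apply/implyP => Eij.
  have iL : i \notin L.
    apply: contraL Eij => /(subsetP sL); rewrite inE => /andP [_ /forall_inP]; exact.
  rewrite (notL i) //; case: (boolP (j \in L)) => jL.
    by rewrite topL // ltnS leq_wmax.
  rewrite notL //; have /forall_inP/(_ i) := iu; rewrite inE iL => /(_ iA).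
  by move=> /forall_inP/(_ j); rewrite inE jL => /(_ jA); rewrite Eij.
- apply/eqP/setP => i; rewrite inE rE tE.
  by case: (boolP (i \in L)) => [/(subsetP sLA) ->|]; rewrite ?andbF.
- apply/eqP/ffunP => i; rewrite !ffunE; case: ifP => iL; last by rewrite iL.
  by apply/val_inj/esym/eqP; rewrite -leqn0 leqNgt h1 inE iL.
Qed.

(** A position carrying the largest letter cannot be the smaller side of a strict constraint. *)
Lemma top_block_sinks E A u : A != set0 -> packed_on A u -> increasing_on E A u ->
  (top_block A u \subset sinks E A) && (top_block A u != set0).
Proof.
move=> A0 pu iu; have [r0 [i ui]] := wmax_attained _ _ pu A0.
have [h1 _] := packed_onP _ _ pu.
apply/andP; split; last first.
  by apply/set0Pn; exists i; rewrite inE ui eqxx -h1 ui r0.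
apply/subsetP => j; rewrite !inE => /andP [jA /eqP uj]; rewrite jA.
apply/forall_inP => k kA; apply/negP => Ejk.
have /forall_inP/(_ j jA)/forall_inP/(_ k kA) := iu.
by rewrite Ejk uj ltnNge leq_wmax.
Qed.

(** The last block of [u] ranges over the nonempty sets of sinks of [E], and the
    alternating sum over these is [-1]. *)
Lemma sum_sign_increasing (R : comPzRingType) E (h : 'I_n -> nat) A :
  (forall i j, E i j -> (h i < h j)%N) ->
  \sum_(u : fword n | packed_on A u && increasing_on E A u)
    (-1) ^+ (#|A| + wmax u) = 1 :> R.
Proof.
move=> hE; have [m] := ubnP #|A|; elim: m A => // m IH A; rewrite ltnS => cA.
have [->|A0] := eqVneq A set0.
  rewrite (big_pred1 [ffun=> ord0]) => [|u].
    rewrite cards0 [wmax _]big1 => [|i _]; last by rewrite ffunE.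
    by rewrite expr0.
  apply/andP/eqP => [[/packed_onP [h1 _] _]|->].
    apply/ffunP => i; rewrite ffunE; apply/val_inj/eqP.
    by rewrite -leqn0 leqNgt h1 inE.
  split; last by apply/forall_inP => i; rewrite inE.
  apply/packed_onP; split=> [i|k]; first by rewrite ffunE inE.
  rewrite [wmax _]big1 => [|i _]; last by rewrite ffunE.
  by case: k.
rewrite (partition_big (top_block A)
  (fun L => (L \subset sinks E A) && (L != set0))) /=; last first.
  by move=> u /andP [pu iu]; apply: top_block_sinks.
rewrite -[RHS]opprK -[X in _ = - X](sum_sign_subsets R _
  (sinks_neq0 _ _ _ hE A0)) -sumrN.
apply: eq_bigr => L /andP [sL L0].
rewrite (reindex_onto (add_top L) (drop_top L)) /=; last first.
  by move=> u /andP [/andP [pu _] /eqP <-]; have [] := drop_topK _ _ A0 pu.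
rewrite (eq_bigl _ _ (fun u => top_blockP E A L u sL L0)).
have sLA : L \subset A.
  by apply: subset_trans sL _; apply/subsetP => i; rewrite inE => /andP [].
have cAL : #|A| = (#|L| + #|A :\: L|)%N by rewrite -(cardsID L A) (setIidPr sLA).
(* Appending [L] raises [wmax] by 1 and the support by [#|L|], hence multiplies the sign by
   [- (-1) ^+ #|L|]. *)
rewrite -[RHS]mulr1 -[X in _ * X](IH (A :\: L)).
  rewrite mulr_sumr; apply: eq_bigr => u /andP [pu _].
  have [-> _] := wmax_add_top _ _ _ pu sLA L0.
  by rewrite cAL addnS exprS -addnA exprD mulN1r mulNr.
apply: leq_trans cA; rewrite cAL -[ltnLHS]add0n ltn_add2r card_gt0 //.
Qed.
End PackedOn.

(** * The involution on LLT series *)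

Section OmegaLLT.
Variable n : nat.
Implicit Types (u v : fword n) (H : graph n) (S : {set 'I_n * 'I_n}).

(** Merging adjacent blocks means that [v i] is a nondecreasing function of [u i]; this is the
    contrapositive form. *)
Lemma mergesP v u :
  reflect (forall i j, (v i < v j)%N -> (u i < u j)%N) (merges v u).
Proof.
apply: (iffP existsP) => [[f /andP [/forallP fM /forallP fB]] i j|h].
  have fu k : v k = f (u k).
    have /eqP/setP/(_ k) := fB (f (u k)); rewrite inE => e; apply/eqP.
    by rewrite e; apply/bigcupP; exists (u k); rewrite ?inE.
  by rewrite !fu; apply: contraTT; rewrite -!leqNgt; apply/implyP/(forallP (fM _)).
(* The merging map sends [k] to the largest letter of [v] at the positions where [u] is at most [k].
   It is nondecreasing by construction, and is also defined at values [k] that are not letters of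
   [u]. *)
have mle k : (\max_(i | (u i <= k)%N) v i < n.+1)%N.
  by rewrite ltnS; apply/bigmax_leqP => i _; rewrite -ltnS.
pose f := [ffun k : 'I_n.+1 => Ordinal (mle k)].
have fu i : f (u i) = v i.
  rewrite ffunE; apply/val_inj/eqP; rewrite eqn_leq /=; apply/andP; split.
    by apply/bigmax_leqP => j; apply: contraTT; rewrite -!ltnNge; apply: h.
  exact: (@leq_bigmax_cond _ (fun j => u j <= u i)%N (fun j => v j : nat)).
exists f; apply/andP; split.
  apply/forallP => j; apply/forallP => k; apply/implyP => jk.
  rewrite !ffunE /=; apply/bigmax_leqP => i uij.
  apply: (@leq_bigmax_cond _ (fun j => u j <= k)%N (fun j => v j : nat)).
  exact: leq_trans jk.
apply/forallP => k; apply/eqP/setP => i; rewrite inE -fu.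
apply/eqP/bigcupP => [e|[j /eqP <-]]; first by exists (u i); rewrite ?e ?inE.
by rewrite inE => /eqP ->.
Qed.

(** If [v] strictly descends along a pair of [S], so does every refinement of [v], and all terms
    vanish. Otherwise refining [v] and ascending along [S] are together the constraints of one
    acyclic relation, and the signed sum is 1. *)
Lemma sum_sign_refinements (R : comPzRingType) S v :
  (forall p, p \in S -> p.1 < p.2)%N ->
  \sum_(u : fword n | packed u && merges v u)
    (-1) ^+ (n - wmax u) * \prod_(p in S) (u p.1 < u p.2)%N%:R =
  \prod_(p in S) (v p.1 <= v p.2)%N%:R :> R.
Proof.
move=> hS; have [/forall_inP vS|] :=
  boolP [forall p in S, v p.1 <= v p.2]%N; last first.
  move=> /forall_inPn [p pS]; rewrite -ltnNge => vp.
  rewrite [RHS](bigD1 p) //= leqNgt vp mul0r big1 // => u.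
  move=> /andP [_ /mergesP/(_ _ _ vp) up].
  by rewrite (bigD1 p) //= ltnNge ltnW // mul0r mulr0.
rewrite [RHS]big1 => [|p /vS -> //].
pose E i j := (v i < v j)%N || ((i, j) \in S).
(* As [i < n], the height [v i * n + i] encodes the lexicographic order on [(v i, i)]. Pairs of [S]
   with equal letters increase it because [p.1 < p.2]. *)
have hE i j : E i j -> (v i * n + i < v j * n + j)%N.
  case: (ltnP (v i) (v j)) => [vij _|vij].
    apply: (@leq_trans (v j * n)); last exact: leq_addr.
    apply: (@leq_trans ((v i).+1 * n)); last by rewrite leq_mul2r vij orbT.
    by rewrite mulSn addnC ltn_add2r.
  rewrite /E ltnNge vij /= => ijS; have := vS _ ijS => /= vji.
  have -> : v i = v j by apply/val_inj/eqP; rewrite eqn_leq vij vji.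
  by rewrite ltn_add2l (hS _ ijS).
rewrite -[RHS](sum_sign_increasing _ R _ _ setT hE).
rewrite big_mkcond [RHS]big_mkcond; apply: eq_bigr => u _.
rewrite -packed_packed_on; case pu : (packed u) => //=.
(* This bound gives [n - wmax u] and [n + wmax u] the same parity, matching the two forms of the
   sign. *)
have wn : (wmax u <= n)%N by apply: wmax_le => i; rewrite -ltnS.
rewrite cardsT card_ord; case: (boolP (increasing_on _ E _ u)) => iu.
  have {}iu i j : E i j -> (u i < u j)%N.
    have /forall_inP/(_ i (in_setT i))/forall_inP/(_ j (in_setT j))/implyP := iu.
    exact.
  have -> : merges v u by apply/mergesP => i j vij; apply: iu; rewrite /E vij.
  rewrite big1 => [|[i j] ijS]; last by rewrite iu // /E ijS orbT.
  by rewrite mulr1 -signr_odd oddB // -oddD signr_odd.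
case: ifP => // /mergesP mu.
have /forall_inPn [p pS pu'] : ~~ [forall p in S, u p.1 < u p.2]%N.
  apply: contraNN iu => /forall_inP uS.
  apply/forall_inP => i _; apply/forall_inP => j _; apply/implyP.
  by case/orP => [/mu //|/uS].
by rewrite (bigD1 p) //= (negPf pu') mul0r mulr0.
Qed.

Definition edges H : {set 'I_n * 'I_n} :=
  [set p : 'I_n * 'I_n | (p.1 < p.2)%N && ([set p.1; p.2] \in H)].

Lemma set2_inj : {in [pred p : 'I_n * 'I_n | p.1 < p.2]%N &,
  injective (fun p => [set p.1; p.2])}.
Proof.
move=> [a b] [c d]; rewrite !inE /= => ab cd e.
have : b \in [set c; d] by rewrite -e set22.
have : a \in [set c; d] by rewrite -e set21.
rewrite !inE => /orP [] /eqP ? /orP [] /eqP ?; subst a b => //.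
- by rewrite ltnn in ab.
- by have := ltn_trans cd ab; rewrite ltnn.
- by rewrite ltnn in ab.
Qed.

(** A [graph] may contain arbitrary vertex sets; only its two-element members correspond to ordered
    pairs. *)
Lemma card_edges H : (forall e, e \in H -> #|e| = 2) -> #|edges H| = #|H|.
Proof.
move=> H2; rewrite -(card_in_imset (f := fun p => [set p.1; p.2])); last first.
  by move=> p q; rewrite !inE => /andP [pp _] /andP [qq _]; apply: set2_inj.
apply: eq_card => e; apply/imsetP/idP => [[p]|eH].
  by rewrite inE => /andP [_ pH] ->.
have /eqP/cards2P [i [j [ij eE]]] := H2 _ eH; rewrite {e}eE in eH *.
have [lt|] := ltnP i j; first by exists (i, j); rewrite // inE lt.
rewrite leq_eqVlt eq_sym (inj_eq val_inj) (negPf ij) /= => lt.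
by exists (j, i); rewrite /= 1?setUC // inE lt setUC.
Qed.

Lemma asc_edges H u : asc H u = #|[set p in edges H | u p.1 < u p.2]%N|.
Proof. by apply: eq_card => p; rewrite !inE -andbA. Qed.

Lemma LLT_word_of (K : fieldType) H (x : K) u : packed u ->
  LLT H x (word_of u) = x ^+ asc H u.
Proof.
move=> pu; rewrite /LLT fct_sumE (bigD1 u) //= big1 => [|w /andP [_ /negPf wu]].
  by rewrite addr0 -[LHS]/(_ * M K u (word_of u)) M_word_of // eqxx mulr1.
by rewrite -[LHS]/(_ * M K w (word_of u)) M_word_of // eq_sym wu mulr0.
Qed.

Lemma omega_LLT_tilde (K : fieldType) H (q : K) :
  q != 0 -> (forall e, e \in H -> #|e| = 2) ->
  omega (LLT_tilde H q) =
  \sum_(v : fword n | packed v)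
    (\prod_(p in edges H) (if (v p.2 < v p.1)%N then q else 1)) *: M K v.
Proof.
move=> q0 H2.
(* The coefficient is [q] to the number of non-ascents; each edge gives a factor affine in the
   indicator of an ascent, ready for expansion. *)
have coef u : packed u -> LLT_tilde H q (word_of u) =
    \prod_(p in edges H) ((1 - q) * (u p.1 < u p.2)%N%:R + q).
  move=> pu; rewrite -[LHS]/(_ * LLT H q^-1 (word_of u)) LLT_word_of //.
  have Hq : q ^+ #|H| = q ^+ asc H u *
      q ^+ #|edges H :\: [set p in edges H | u p.1 < u p.2]%N|.
    rewrite -exprD asc_edges -card_edges //.
    rewrite -(cardsID [set p in edges H | u p.1 < u p.2]%N (edges H)).
    congr (_ ^+ (#|pred_of_set _| + _)); apply/setP => p.
    by rewrite !inE andbA andbb.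
  rewrite Hq mulrAC exprVn divff ?expf_neq0 // mul1r.
  rewrite (bigID (fun p => u p.1 < u p.2)%N) /=.
  rewrite (eq_bigr (fun=> 1)) => [|p /andP [_ ->]]; last by rewrite mulr1 subrK.
  rewrite big1_eq mul1r (eq_bigr (fun=> q)) => [|p /andP [_ /negPf ->]]; last first.
    by rewrite mulr0 add0r.
  rewrite prodr_const; congr (_ ^+ _); apply: eq_card => p.
  rewrite [RHS]unfold_in !inE.
  by case: (u p.1 < u p.2)%N; case: (p.1 < p.2)%N; case: (_ \in H).
rewrite /omega; under eq_bigr => u pu do
  rewrite coef // scaler_sumr scaler_sumr.
rewrite (exchange_big_dep (@packed n)) /=; last by move=> u v _ /andP [].
apply: eq_bigr => v pv; under eq_bigr => u _ do rewrite scalerA.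
rewrite -scaler_suml; congr (_ *: _).
(* The signed sum replaces strict ascents of [u] by weak ascents of [v]: this is
   [sum_sign_refinements], applied to each set [S] of edges in the expansion. *)
transitivity (\prod_(p in edges H) ((1 - q) * (v p.1 <= v p.2)%N%:R + q));
  last first.
  apply: eq_bigr => p _; rewrite ltnNge.
  by case: (v p.1 <= v p.2)%N; rewrite ?mulr1 ?subrK // mulr0 add0r.
rewrite prod_subset_distr; under eq_bigr => u _ do
  rewrite prod_subset_distr mulr_suml.
rewrite exchange_big /=; apply: eq_bigr => S sSH.
rewrite big_split /= -sum_sign_refinements; last first.
  by move=> p /(subsetP sSH); rewrite inE => /andP [].
rewrite mulr_sumr mulr_suml; apply: eq_big => [u|u _]; first by rewrite pv.
by rewrite big_split /=; ring.
Qed.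
End OmegaLLT.

(** * Standardization *)

Section Standardization.
Variable n : nat.
Implicit Types (v : fword n) (s : 'S_n).

(** This allows [Inv] and [Des] of [s] to be read off any word with standardization [s]. Injectivity
    of [s] turns the negated strict inequality into a strict one. *)
Lemma is_std_ltn v s (i j : 'I_n) :
  is_std v s -> (i < j)%N -> (s j < s i)%N = (v j < v i)%N.
Proof.
move=> /forallP/(_ i)/forallP/(_ j)/implyP h ij.
have /eqP h' := h ij; rewrite [RHS]ltnNge -h' -leqNgt [RHS]leq_eqVlt [RHS]orb_idl //.
by move=> /eqP/val_inj/perm_inj ji; rewrite ji ltnn in ij.
Qed.

(** The inversions determine the whole order of the entries, and [s i] is the number of entries
    smaller than it. *)
Lemma perm_ltn_inj s s' :
  (forall i j : 'I_n, (i < j)%N -> (s j < s i)%N = (s' j < s' i)%N) -> s = s'.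
Proof.
move=> h; have lt i j : (s j < s i)%N = (s' j < s' i)%N.
  case: (ltngtP i j) => [/h //|ji|/val_inj ->]; last by rewrite !ltnn.
  rewrite [LHS]ltnNge leq_eqVlt h // (inj_eq val_inj).
  by rewrite [RHS]ltnNge [in RHS]leq_eqVlt (inj_eq val_inj) !(inj_eq perm_inj).
have cnt (r : 'S_n) i : #|[set j | r j < r i]%N| = r i.
  rewrite -[LHS](card_imset _ (@perm_inj _ r)) -[RHS]card_ord.
  rewrite -(card_imset _ (f := widen_ord (ltnW (ltn_ord (r i))))); last first.
    by move=> a b [] /val_inj.
  apply: eq_card => k; apply/imsetP/imsetP => [[j]|[l _ ->]].
    by rewrite inE => ji ->; exists (Ordinal ji) => //; apply/val_inj.
  by exists (r^-1 (widen_ord (ltnW (ltn_ord (r i))) l))%g; rewrite ?inE permKV //=.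
apply/permP => i; apply/val_inj; rewrite /= -[LHS]cnt -[RHS]cnt; apply: eq_card => j.
by rewrite !inE lt.
Qed.

(** The positions are ranked by the lexicographic order on [(v i, i)], so that equal letters are
    numbered from left to right. *)
Lemma std_exists v : exists s, is_std v s.
Proof.
pose key i := (v i * n + i)%N.
have keylt (i j : 'I_n) : (i < j)%N -> (key i < key j)%N = (v i <= v j)%N.
  move=> ij; rewrite /key; have := ltn_ord i; have := ltn_ord j.
  by case: leqP => vij; nia.
have keyne (i j : 'I_n) : (i < j)%N -> key i <> key j.
  move=> ij; rewrite /key; have := ltn_ord i; have := ltn_ord j.
  by case: (ltngtP (v i) (v j)) => [h|h|->]; nia.
have rkn i : (#|[set j | key j < key i]%N| < n)%N.
  rewrite -[ltnRHS]card_ord -cardsT; apply/proper_card/properP; split=> //.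
  by exists i; rewrite // inE ltnn.
pose rk i := Ordinal (rkn i).
have rklt (i j : 'I_n) : (key i < key j)%N -> (rk i < rk j)%N.
  move=> kij; apply/proper_card/properP; split.
    by apply/subsetP => k; rewrite !inE => /ltn_trans; apply.
  by exists i; rewrite !inE ?ltnn.
have rkI : injective rk.
  move=> i j e; have kij : key i = key j.
    have [/rklt|/rklt|//] := ltngtP (key i) (key j); by rewrite e ltnn.
  by apply/val_inj; have [/keyne|/keyne|//] := ltngtP i j; rewrite kij.
exists (perm rkI); apply/forallP => i; apply/forallP => j; apply/implyP => ij.
rewrite !permE -keylt //; apply/eqP; apply/idP/idP; last exact: rklt.
apply: contraTT; rewrite -!leqNgt leq_eqVlt.
by move=> /orP [/eqP/esym/(keyne _ _ ij) //|/rklt/ltnW].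
Qed.

(** Each packed [v] occurs in exactly one [Phi_min s], that of its standardization. *)
Lemma sum_Phi_min (K : fieldType) (c : 'S_n -> K) (d : fword n -> K) :
  (forall v s, is_std v s -> c s = d v) ->
  \sum_(s : 'S_n) c s *: Phi_min K s = \sum_(v : fword n | packed v) d v *: M K v.
Proof.
move=> cd; under eq_bigr => s _ do rewrite scaler_sumr.
rewrite (exchange_big_dep (@packed n)) /=; last by move=> s v _ /andP [].
apply: eq_bigr => v pv; have [s0 vs0] := std_exists v.
rewrite (big_pred1 s0) ?(cd v) // => s; rewrite pv /=; apply/idP/eqP => [vs|->//].
apply: perm_ltn_inj => i j ij.
by rewrite (is_std_ltn _ _ _ _ vs) // (is_std_ltn _ _ _ _ vs0).
Qed.
End Standardization.

(** * Cells of a partition *)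

Section PartitionDiagram.
Variables (n : nat) (mu : seq nat).
Hypothesis mu_part : is_partition_of n mu.
Implicit Types u v : 'I_n.
Local Open Scope nat_scope.

Let row r := nth 0 mu r.

Lemma sum_row : \sum_(0 <= r < size mu) row r = n.
Proof. by have /and3P [_ _ /eqP <-] := mu_part; rewrite sumnE [RHS](big_nth 0). Qed.

Lemma row_mono i j : i <= j -> row j <= row i.
Proof.
move=> ij; have /and3P [smu _ _] := mu_part.
have [js|js] := leqP (size mu) j; first by rewrite /row nth_default.
have geq_trans : transitive geq by move=> b a c /= ba cb; apply: leq_trans cb ba.
apply: (sorted_leq_nth geq_trans leqnn 0 smu) (ij); rewrite inE //.
exact: leq_ltn_trans ij js.
Qed.

Lemma big_cells (F : nat * nat -> nat) :
  \sum_(x <- cells mu) F x =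
  \sum_(0 <= r < size mu) \sum_(0 <= c < row r) F (r, c).
Proof.
rewrite /cells big_allpairs_dep (perm_big (iota 0 (size mu))) /=; last first.
  by rewrite perm_rev.
by rewrite /index_iota subn0; apply: eq_bigr => r _; rewrite subn0.
Qed.

Lemma size_cells : size (cells mu) = n.
Proof.
rewrite -sum1_size big_cells -[RHS]sum_row.
by apply: eq_bigr => r _; rewrite sum_nat_const_nat subn0 muln1.
Qed.

Lemma sum_cell (F : nat * nat -> nat) :
  \sum_(u < n) F (cell mu u) =
  \sum_(0 <= r < size mu) \sum_(0 <= c < row r) F (r, c).
Proof. by rewrite -big_cells (big_nth (0, 0)) size_cells big_mkord. Qed.

Lemma mem_cells x : (x \in cells mu) = (x.1 < size mu) && (x.2 < row x.1).
Proof.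
case: x => r c /=; apply/allpairsPdep/andP => [[r' [c' [+ + [-> ->]]]]|[rs cr]].
  by rewrite mem_rev !mem_iota.
by exists r, c; rewrite mem_rev !mem_iota.
Qed.

Lemma cell_inj : injective (@cell n mu).
Proof.
have uc : uniq (cells mu).
  apply: allpairs_uniq_dep => [|r _|[r c] [r' c'] _ _ [-> ->] //].
    by rewrite rev_uniq iota_uniq.
  exact: iota_uniq.
move=> u v /eqP; rewrite /cell nth_uniq ?size_cells //.
by move=> /eqP/val_inj.
Qed.

Lemma cellP u : (crow mu u < size mu) && (ccol mu u < row (crow mu u)).
Proof. by rewrite -mem_cells mem_nth // size_cells. Qed.

Lemma cell_exists x : x.1 < size mu -> x.2 < row x.1 -> exists u, cell mu u = x.
Proof.
move=> x1 x2; have xc : x \in cells mu by rewrite mem_cells x1.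
have lt : index x (cells mu) < n by rewrite -size_cells index_mem.
by exists (Ordinal lt); rewrite /cell nth_index.
Qed.

Lemma crow_mono u v : u < v -> crow mu v <= crow mu u.
Proof.
(* Reading order lists the rows from top to bottom; the claim is generalized to any weakly
   decreasing list of row indices for the induction. *)
have pw (s : seq nat) (t : nat -> seq nat) : pairwise geq s ->
    pairwise (fun x y => y.1 <= x.1) [seq (r, c) | r <- s, c <- t r].
  elim: s => // r s IH /= /andP [/allP rs /IH ps].
  rewrite pairwise_cat ps andbT; apply/andP; split.
    apply/allrelP => _ y /mapP [c _ ->] /allpairsPdep [r' [c' [r's _ ->]]] /=.
    exact: rs.
  by rewrite pairwise_map; apply/(pairwiseP 0) => *; rewrite /= leqnn.
move=> uv; have := pw (rev (iota 0 (size mu))) (fun r => iota 0 (nth 0 mu r)).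
rewrite -sorted_pairwise; last by move=> a b c /= ab bc; apply: leq_trans bc ab.
rewrite rev_sorted => /(_ (iota_sorted _ _))/(pairwiseP (0, 0)); apply=> //;
  by rewrite inE size_cells.
Qed.

(** Row lengths weakly decrease upwards, so the cell below exists and the default in [South] is not
    reached. *)
Lemma cell_South u : ~~ in_bottom mu u ->
  cell mu (South mu u) = ((crow mu u).-1, ccol mu u).
Proof.
rewrite /in_bottom -lt0n => r0; have /andP [rs cr] := cellP u.
rewrite /South; case: pickP => [v /eqP //|h].
have [||v /eqP] := cell_exists ((crow mu u).-1, ccol mu u) => /=.
- exact: leq_ltn_trans (leq_pred _) rs.
- exact: leq_trans cr (row_mono _ _ (leq_pred _)).
- by rewrite h.
Qed.

Lemma crow_South u : ~~ in_bottom mu u -> crow mu u = (crow mu (South mu u)).+1.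
Proof.
by move=> nb; rewrite /crow (cell_South _ nb) /= prednK // lt0n.
Qed.

Lemma ccol_South u : ~~ in_bottom mu u -> ccol mu (South mu u) = ccol mu u.
Proof. by move=> nb; rewrite /ccol (cell_South _ nb). Qed.

Lemma ltn_South u : ~~ in_bottom mu u -> u < South mu u.
Proof.
move=> nb; have := crow_South _ nb.
by case: ltngtP => // [/crow_mono|/val_inj <-]; lia.
Qed.

(** Attacks between consecutive rows need distinct columns. Hence the edges added in [Gmu_plus] are
    not in [Gmu]. *)
Lemma attack_South u : ~~ in_bottom mu u -> attack mu u (South mu u) = false.
Proof.
move=> nb; rewrite /attack (ccol_South _ nb) ltnn !andbF !orbF (crow_South _ nb).
by rewrite gtn_eqF ?andbF.
Qed.

Lemma card_left v :
  #|[set u : 'I_n | (crow mu u == crow mu v) && (ccol mu u < ccol mu v)]| =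
  ccol mu v.
Proof.
have /andP [rs cr] := cellP v.
rewrite -sum1_card big_mkcond /=; under eq_bigr => u _ do rewrite inE.
rewrite (sum_cell (fun x =>
  if (x.1 == crow mu v) && (x.2 < ccol mu v) then 1 else 0)).
rewrite (eq_bigr (fun r => if r == crow mu v then ccol mu v else 0)) => [|r _].
  by rewrite -big_mkcond big_nat1_eq rs.
case: eqP => [->|_]; last by rewrite big1.
rewrite /= -big_mkcond -(big_nat_widen _ _ _ predT) ?(ltnW cr) //.
by rewrite sum_nat_const_nat subn0 muln1.
Qed.

(** Row indices start at 0, so leaving out the bottom row makes the count exactly the row index. *)
Lemma card_below v :
  #|[set u : 'I_n | (ccol mu u == ccol mu v) && (0 < crow mu u <= crow mu v)]| =
  crow mu v.
Proof.
have /andP [rs cr] := cellP v.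
rewrite -sum1_card big_mkcond /=; under eq_bigr => u _ do rewrite inE.
rewrite (sum_cell (fun x =>
  if (x.2 == ccol mu v) && (0 < x.1 <= crow mu v) then 1 else 0)) /=.
rewrite (eq_bigr (fun r =>
  if (0 < r) && (r < (crow mu v).+1) then 1 else 0)) => [|r _].
  rewrite -big_mkcond -(big_nat_widen _ _ _ (fun r => 0 < r)) //.
  rewrite big_mkcond big_nat_recl //= add0n.
  by rewrite sum_nat_const_nat subn0 muln1.
rewrite ltnS; case: ifP => [/andP [r0 rv]|rv]; last first.
  by rewrite big1 // => c _; rewrite andbF.
under eq_bigr => c _ do rewrite andbT.
by rewrite -big_mkcond big_nat1_eq /= (leq_trans cr) // row_mono.
Qed.

(** Counting pairs of cells in a row by their right end turns the sum of the arms
    into the sum of the column indices. *)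
Lemma sum_arm : \sum_(u : 'I_n | ~~ in_bottom mu u) arm mu u + 'C(head 0 mu, 2) =
  npart (conj_part mu).
Proof.
have -> : \sum_(u : 'I_n | ~~ in_bottom mu u) arm mu u =
    \sum_(0 <= r < size mu) (if r == 0 then 0 else 'C(row r, 2)).
  transitivity (\sum_(u : 'I_n | ~~ in_bottom mu u) ccol mu u).
    under eq_bigr => u _ do rewrite /arm -sum1_card big_mkcond /=.
    rewrite exchange_big /= [RHS]big_mkcond; apply: eq_bigr => v _.
    case: ifPn => [nb|]; last first.
      rewrite negbK => b; rewrite big1 // => u nbu; rewrite inE.
      case: eqP => // e; rewrite -/(crow mu v) /in_bottom -e in nbu b.
      by rewrite b in nbu.
    rewrite -[RHS]card_left -sum1_card -big_mkcondr; apply: eq_bigl => u.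
    rewrite !inE eq_sym; case: eqP => [e|]; last by rewrite andbF.
    by rewrite /in_bottom e -/(in_bottom mu v) nb.
  rewrite big_mkcond (sum_cell (fun x => if x.1 != 0 then x.2 else 0)).
  apply: eq_bigr => r _ /=; case: eqP => _; first by rewrite big1.
  exact: bin2_sum.
(* Column [i] has one cell for each row longer than [i]; exchanging the sums, row [r] contributes
   the sum of all [i < row r], that is ['C(row r, 2)]. *)
have -> : npart (conj_part mu) = \sum_(0 <= r < size mu) 'C(row r, 2).
  rewrite /npart /conj_part size_map size_iota.
  rewrite -(big_mkord predT (fun i =>
    i * nth 0 [seq count (ltn j) mu | j <- iota 0 (head 0 mu)] i)).
  transitivity (\sum_(0 <= i < head 0 mu)
      \sum_(0 <= r < size mu) if i < row r then i else 0); last first.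
    rewrite exchange_big /=; apply: eq_bigr => r _.
    rewrite -big_mkcond -(big_nat_widen _ _ _ predT) ?bin2_sum //.
    by rewrite -nth0; apply: row_mono.
  apply: eq_big_nat => i /andP [_ ih].
  rewrite (nth_map 0) ?size_iota // nth_iota // add0n -sum1_count big_mkcond.
  rewrite (big_nth 0) big_distrr /=; apply: eq_bigr => r _.
  by rewrite -/(row r); case: ifP; rewrite ?muln1 ?muln0.
case smu : (size mu) => [|k].
  by rewrite !big_geq // (size0nil smu).
rewrite !big_nat_recl //= add0n addnC -nth0; congr (_ + _).
Qed.

(** Likewise, counting pairs of cells in a column by their upper end gives the
    sum of the row indices. *)
Lemma sum_leg : \sum_(u : 'I_n | ~~ in_bottom mu u) (1 + leg mu u) = npart mu.
Proof.
have legE u : 1 + leg mu u =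
    #|[set v : 'I_n | (ccol mu v == ccol mu u) && (crow mu u <= crow mu v)]|.
  rewrite (cardsD1 u) !inE eqxx leqnn /leg; congr (_ + _); apply: eq_card => v.
  rewrite !inE ltn_neqAle; case: eqP => [vc|]; last by rewrite andbF.
  rewrite /= andbC [RHS]andbC; congr (_ && ~~ _); apply/eqP/eqP => [rr|-> //].
  apply: cell_inj; rewrite [LHS]surjective_pairing [RHS]surjective_pairing.
  by congr (_, _).
under eq_bigr => u _ do rewrite legE -sum1_card big_mkcond /=.
rewrite exchange_big /= /npart -(big_mkord predT (fun i => i * row i)).
rewrite (eq_bigr (fun v => crow mu v)) => [|v _]; last first.
  rewrite -[RHS]card_below -sum1_card -big_mkcondr; apply: eq_bigl => u.
  by rewrite !inE eq_sym /in_bottom -lt0n; case: (0 < _); rewrite ?andbF.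
rewrite (sum_cell (fun x => x.1)); apply: eq_bigr => r _.
by rewrite sum_nat_const_nat subn0 mulnC.
Qed.

Lemma card_nonbottom : #|[set u : 'I_n | ~~ in_bottom mu u]| = n - head 0 mu.
Proof.
rewrite -sum1_card big_mkcond /=; under eq_bigr => u _ do rewrite inE.
rewrite (sum_cell (fun x => if x.1 != 0 then 1 else 0)) /= -sum_row.
case smu : (size mu) => [|k]; first by rewrite !big_geq.
rewrite !big_nat_recl //= [X in X + _]big1 // add0n -nth0 addKn.
by apply: eq_bigr => r _; rewrite sum_nat_const_nat subn0 muln1.
Qed.
End PartitionDiagram.

(** * Graphs between [Gmu] and [Gmu_plus] *)

Section IntermediateGraphs.
Variables (n : nat) (mu : seq nat).
Hypothesis mu_part : is_partition_of n mu.
Implicit Types (u v : 'I_n) (H : graph n) (J : {set 'I_n}).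

Definition nonbottom : {set 'I_n} := [set u | ~~ in_bottom mu u].

Definition graph_of J : graph n :=
  Gmu n mu :|: [set [set u; South mu u] | u in J].

Lemma attack_sym u v : attack mu u v = attack mu v u.
Proof.
rewrite /attack (eq_sym u) (eq_sym (crow mu u) (crow mu v)).
by congr (_ || _); rewrite orbC.
Qed.

Lemma mem_Gmu u v : (u < v)%N -> ([set u; v] \in Gmu n mu) = attack mu u v.
Proof.
move=> uv; apply/imsetP/idP => [[[a b]]|uv_att]; last by exists (u, v); rewrite ?inE.
rewrite inE /= => ab e.
have [lt|] := ltnP a b.
  by have [-> ->] := set2_inj n (u, v) (a, b) uv lt e.
rewrite leq_eqVlt => /orP [/eqP/val_inj ba|lt].
  by move: ab; rewrite ba /attack eqxx /= !ltnn !andbF.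
rewrite [RHS]setUC in e; rewrite attack_sym in ab.
by have [-> ->] := set2_inj n (u, v) (b, a) uv lt e.
Qed.

Lemma South_notin_Gmu u : u \in nonbottom -> [set u; South mu u] \notin Gmu n mu.
Proof.
by rewrite inE => nb; rewrite mem_Gmu ?attack_South // ltn_South.
Qed.

(** The cell [u] is recovered as the smaller end of its edge, since [South mu u] comes later in
    reading order. *)
Lemma South_edge_inj u v : u \in nonbottom -> v \in nonbottom ->
  [set u; South mu u] = [set v; South mu v] -> u = v.
Proof.
rewrite !inE => unb vnb e.
by have [] := set2_inj n (u, South mu u) (v, South mu v)
  (ltn_South _ _ mu_part _ unb) (ltn_South _ _ mu_part _ vnb) e.
Qed.

Lemma mem_graph_of J u : J \subset nonbottom -> u \in nonbottom ->
  ([set u; South mu u] \in graph_of J) = (u \in J).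
Proof.
move=> /subsetP sJ unb; rewrite inE (negPf (South_notin_Gmu _ unb)) /=.
apply/imsetP/idP => [[v vJ e]|uJ]; last by exists u.
by rewrite (South_edge_inj _ _ unb (sJ _ vJ) e).
Qed.

Lemma card_edge_graph_of J e : J \subset nonbottom -> e \in graph_of J -> #|e| = 2.
Proof.
move=> /subsetP sJ; rewrite inE => /orP [/imsetP [[a b] + ->]|/imsetP [u /sJ + ->]].
  rewrite inE /= => ab; rewrite cards2; case: eqP => // e_ab.
  by move: ab; rewrite e_ab /attack eqxx /= !ltnn !andbF.
rewrite inE => /(ltn_South _ _ mu_part) uS.
by rewrite cards2 -(inj_eq val_inj) ltn_eqF.
Qed.

(** An added edge is oriented from [u] to [South mu u], so a strict descent along it is a descent of
    the filling at [u]. *)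
Lemma edges_graph_of J : J \subset nonbottom ->
  edges n (graph_of J) =
  [set p : 'I_n * 'I_n | attack mu p.1 p.2 && (p.1 < p.2)%N] :|:
  [set (u, South mu u) | u in J].
Proof.
move=> /subsetP sJ; apply/setP => -[a b]; rewrite !inE /=.
have [ab|ba] := boolP (a < b)%N; rewrite /= ?andbF ?andbT.
  rewrite mem_Gmu //; congr (_ || _); apply/imsetP/imsetP => [] [u uJ].
    move=> e; exists u => //; have := sJ _ uJ; rewrite inE => unb.
    exact: set2_inj n (a, b) (u, South mu u) ab (ltn_South _ _ mu_part _ unb) e.
  by move=> [-> ->]; exists u.
apply/esym/imsetP => -[u /sJ]; rewrite inE => /(ltn_South _ _ mu_part) uS [ea eb].
by rewrite ea eb uS in ba.
Qed.

(** An intermediate graph is determined by the cells whose edge to the south it contains, and any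
    set of nonbottom cells arises, these edges being distinct and outside [Gmu]. *)
Lemma sum_intermediate_graphs (V : nmodType) (F : graph n -> V) :
  \sum_(H : graph n | (Gmu n mu \subset H) && (H \subset Gmu_plus n mu)) F H =
  \sum_(J : {set 'I_n} | J \subset nonbottom) F (graph_of J).
Proof.
rewrite (reindex_onto graph_of
  (fun H => [set u in nonbottom | [set u; South mu u] \in H])) /=; last first.
  move=> H /andP [GH /subsetP HG]; apply/setP => e; rewrite inE.
  apply/orP/idP => [[/(subsetP GH) //|/imsetP [u + ->]]|eH].
    by rewrite inE => /andP [].
  have := HG _ eH; rewrite inE => /orP [|/imsetP [u unb eE]]; first by left.
  right; apply/imsetP; exists u => //; rewrite inE -eE eH andbT inE.
  by move: unb; rewrite inE.
apply: eq_bigl => J; apply/idP/idP => [/andP [_ /eqP <-]|sJ].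
  by apply/subsetP => u; rewrite inE => /andP [].
rewrite subsetUl setUS /=; last first.
  apply/subsetP => _ /imsetP [u uJ ->]; apply/imsetP; exists u => //.
  by have := subsetP sJ _ uJ; rewrite !inE.
apply/eqP/setP => u; rewrite inE.
case: (boolP (u \in nonbottom)) => unb /=; first exact: mem_graph_of.
by apply/esym; apply: contraNF unb; apply/subsetP.
Qed.
End IntermediateGraphs.

(** * Coefficients of both sides on the basis [M v] *)

Section Coefficients.
Variables (K : fieldType) (q t : K) (n : nat) (mu : seq nat).
Hypotheses (q_neq0 : q != 0) (q_neq1 : q != 1) (mu_part : is_partition_of n mu).
Variable v : fword n.

(** [word_Des] and [word_Inv] coincide with [Des] and [Inv] of the standardization of [v]. *)
Definition word_Des : {set 'I_n} :=
  [set u | ~~ in_bottom mu u && (v (South mu u) < v u)%N].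

Definition word_Inv : {set 'I_n * 'I_n} :=
  [set p | [&& attack mu p.1 p.2, p.1 < p.2 & v p.2 < v p.1]%N].

Local Notation NB := (nonbottom n mu).
Local Notation D := word_Des.
Local Notation Iv := word_Inv.

(** By [sum_leg], subtracting [maj] from [npart mu] leaves the sum of [1 + leg] over the
    nondescents, so the power of [t] has a natural exponent. *)
Lemma Hmac_coef (s : 'S_n) : is_std v s ->
  t ^ ((npart mu)%:Z - (maj mu s)%:Z) * q ^ Defs.inv mu s =
  t ^+ (\sum_(u in NB :\: D) (1 + leg mu u)) *
  q ^ (#|Iv|%:Z - (\sum_(u in D) arm mu u)%N%:Z).
Proof.
move=> vs; have DE : Des mu s = D.
  apply/setP => u; rewrite !inE; case: (boolP (in_bottom mu u)) => //= nb.
  exact: is_std_ltn vs (ltn_South _ _ mu_part _ nb).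
have IE : Defs.Inv mu s = Iv.
  apply/setP => p; rewrite !inE; case: (boolP (p.1 < p.2)%N) => //= lt.
  by rewrite (is_std_ltn _ _ _ _ _ vs lt).
rewrite /Defs.inv /maj DE IE -(sum_leg _ _ mu_part); congr (_ * _).
rewrite exprnP; congr (_ ^ _).
have DNB : D \subset NB by apply/subsetP => u; rewrite !inE => /andP [].
have -> : (\sum_(u : 'I_n | ~~ in_bottom mu u) (1 + leg mu u) =
   \sum_(u in NB) (1 + leg mu u))%N by apply: eq_bigl => u; rewrite inE.
by rewrite (big_setID D) /= (setIidPr DNB) PoszD addrAC subrr add0r.
Qed.

Lemma graph_sum_coef :
  q ^ (- (npart (conj_part mu))%:Z + ('C(head 0%N mu, 2))%:Z)
     / (q - 1) ^+ (n - head 0%N mu) *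
  \sum_(J : {set 'I_n} | J \subset NB)
    ((\prod_(u in J) (1 - t ^+ (1 + leg mu u) * q ^+ arm mu u)) *
     (\prod_(u in NB :\: J) (t ^+ (1 + leg mu u) * q ^+ (arm mu u + 1) - 1)) *
     \prod_(p in edges n (graph_of n mu J)) (if (v p.2 < v p.1)%N then q else 1)) =
  t ^+ (\sum_(u in NB :\: D) (1 + leg mu u)) *
  q ^ (#|Iv|%:Z - (\sum_(u in D) arm mu u)%N%:Z).
Proof.
have DNB : D \subset NB by apply/subsetP => u; rewrite !inE => /andP [].
(* The edges of [Gmu] give the inversions of [v] whatever [J] is; the added edges give the descents
   lying in [J]. *)
have wE (J : {set 'I_n}) : J \subset NB ->
    \prod_(p in edges n (graph_of n mu J)) (if (v p.2 < v p.1)%N then q else 1) =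
    q ^+ #|Iv| * \prod_(u in J) (if u \in D then q else 1).
  move=> sJ; rewrite edges_graph_of //.
  set E1 := [set p | _]; set E2 := [set (u, _) | u in J].
  rewrite (eq_bigl [predU E1 & E2]) => [|p]; last exact: in_setU.
  rewrite bigU /=; last first.
    rewrite disjoint_sym disjoints_subset; apply/subsetP => _ /imsetP [u uJ ->].
    by have := subsetP sJ _ uJ; rewrite !inE => /(attack_South _ _ mu_part) ->.
  congr (_ * _).
    rewrite -big_mkcondr prodr_const; congr (_ ^+ _); apply: eq_card => p.
    by rewrite unfold_in !inE andbA.
  rewrite big_imset /=; last by move=> u u' _ _ [].
  by apply: eq_bigr => u uJ; have := subsetP sJ _ uJ; rewrite !inE => ->.
rewrite (eq_bigr (fun J : {set 'I_n} => q ^+ #|Iv| *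
   ((\prod_(u in J) ((1 - t ^+ (1 + leg mu u) * q ^+ arm mu u) *
       (if u \in D then q else 1))) *
     \prod_(u in NB :\: J) (t ^+ (1 + leg mu u) * q ^+ (arm mu u + 1) - 1))));
  last by move=> J sJ; rewrite wE // big_split /=; ring.
rewrite -mulr_sumr -prod_subset_distr.
(* With [T = t ^+ (1 + leg mu u) * q ^+ arm mu u], the factor of a descent is
   [q * (1 - T) + (T * q - 1) = q - 1], and that of a nondescent is
   [(1 - T) + (T * q - 1) = T * (q - 1)]. *)
rewrite (eq_bigr (fun u => (q - 1) * 
   (if u \in D then 1 else t ^+ (1 + leg mu u) * q ^+ arm mu u))); last first.
  by move=> u _; rewrite addn1 exprS; case: ifP => _; ring.
rewrite big_split /= prodr_const card_nonbottom //.
rewrite (big_setID D) /= (setIidPr DNB) big1 ?mul1r; last by move=> u ->.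
rewrite (eq_bigr (fun u => t ^+ (1 + leg mu u) * q ^+ arm mu u)); last first.
  by move=> u; rewrite inE => /andP [/negPf ->].
(* By [sum_arm] the prefactor is [q] to minus the sum of all arms. The arms of the nondescents
   cancel against the product, leaving minus the arms of the descents. *)
rewrite big_split /= !prodrXr -(sum_arm _ _ mu_part) PoszD opprD addrNK.
have -> : (\sum_(u : 'I_n | ~~ in_bottom mu u) arm mu u =
    \sum_(u in D) arm mu u + \sum_(u in NB :\: D) arm mu u)%N.
  rewrite -[in X in (X + _)%N](setIidPr DNB) -big_setID.
  by apply: eq_bigl => u; rewrite inE.
set d := (\sum_(u in D) _)%N; set e := (\sum_(u in _ :\: _) arm _ _)%N.
set T := t ^+ _; set N := (n - _)%N.
have N0 : (q - 1) ^+ N != 0 by rewrite expf_neq0 // subr_eq0.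
have -> : q ^ (#|Iv|%:Z - d%:Z) = q ^ (- (d + e)%N%:Z) * q ^+ #|Iv| * q ^+ e.
  by rewrite !exprnP -!expfzDr //; congr (_ ^ _); lia.
by field.
Qed.
End Coefficients.

Theorem theorem4p1 (K : fieldType) (q t : K) (n : nat) (mu : seq nat)
    (q_neq0 : q != 0) (q_neq1 : q != 1) (mu_part : is_partition_of n mu) :
  Hmac n mu q t =
  (q ^ (- (npart (conj_part mu))%:Z + ('C(head 0%N mu, 2))%:Z)
     / (q - 1) ^+ (n - head 0%N mu)) *:
  \sum_(H : graph n | (Gmu n mu \subset H) && (H \subset Gmu_plus n mu))
    ((\prod_(u : 'I_n | ~~ in_bottom mu u && ([set u; South mu u] \in H))
        (1 - t ^+ (1 + leg mu u) * q ^+ arm mu u)) *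
     (\prod_(u : 'I_n | ~~ in_bottom mu u && ([set u; South mu u] \notin H))
        (t ^+ (1 + leg mu u) * q ^+ (arm mu u + 1) - 1))) *:
    omega (LLT_tilde H q).
Proof.
(* The coefficient of [Phi_min s] is the same expression in every [v] with standardization [s], so
   the left side becomes a sum over packed words, already with the coefficients of the right
   side. *)
rewrite sum_intermediate_graphs // /Hmac (sum_Phi_min _ _ _ _ (fun v s vs =>
  etrans (Hmac_coef K q t n mu mu_part v s vs)
    (esym (graph_sum_coef K q t n mu q_neq0 q_neq1 mu_part v)))).
under eq_bigr => v _ do rewrite -scalerA scaler_suml.
rewrite -scaler_sumr exchange_big /=; congr (_ *: _); apply: eq_bigr => J sJ.
rewrite omega_LLT_tilde //; last by move=> e; apply: card_edge_graph_of.
rewrite scaler_sumr; apply: eq_bigr => v _; rewrite scalerA.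
(* The products over cells with their edge inside or outside [graph_of J] are those over [J] and
   over its complement in [nonbottom]. *)
congr ((_ * _ * _) *: _); apply: eq_bigl => u.
  have [nb|b] := boolP (in_bottom mu u); last first.
    by rewrite mem_graph_of ?inE.
  by apply: contraTF nb => /(subsetP sJ); rewrite inE.
rewrite in_setD [u \in nonbottom _ _]inE.
have [nb|b] := boolP (in_bottom mu u); first by rewrite andbF.
by rewrite mem_graph_of ?inE // andbT.
Qed.
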